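(* Let $f,g,h$ be as in the context, let $x^k\in\mathbb{R}^n$, $\eta^k\in\partial h(x^k)$, let $\lambda,\mu>0$, and define $T_k^{\lambda,\mu}:\mathbb{R}^n\to\mathbb{R}^n$ by $$T_k^{\lambda,\mu}(x)=(1-\mu\lambda)x-\mu\nabla f(x)+\mu\lambda x^k+\mu\eta^k,\qquad x\in\mathbb{R}^n.$$ Then the following hold. (i) A point $x^{k+1}\in\mathbb{R}^n$ solves the subproblem $$x^{k+1}=\operatorname*{arg\,min}_{x\in\mathbb{R}^n}\Big\{f(x)+g(x)-\langle\eta^k,x\rangle+\frac{\lambda}{2}\|x-x^k\|^2\Big\}$$ if and only if it is a fixed point of ${\rm Prox}_{\mu g}\circ T_k^{\lambda,\mu}$, i.e. ${\rm Prox}_{\mu g}\big(T_k^{\lambda,\mu}(x^{k+1})\big)=x^{k+1}$. (ii) For any $\lambda>0$ and $\mu\in\big(0,\frac{2}{2\lambda+L_f}\big]$, the mapping ${\rm Prox}_{\mu g}\circ T_k^{\lambda,\mu}:\mathbb{R}^n\to\mathbb{R}^n$ is a contraction with coefficient $1-\mu\lambda$. For given $\lambda>0$, the coefficient $1-\mu\lambda$ (over $\mu$ in this interval) reaches its minimum $\frac{L_f}{2\lambda+L_f}$ when $\mu=\frac{2}{2\lambda+L_f}$.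
   Context: $\mathbb{R}^n$ carries the Euclidean inner product $\langle\cdot,\cdot\rangle$ and norm $\|\cdot\|$. Standing assumptions: $f:\mathbb{R}^n\to\mathbb{R}$ is a smooth convex function whose gradient is Lipschitz continuous with constant $L_f>0$; $g:\mathbb{R}^n\to(-\infty,+\infty]$ is proper, convex and lower semicontinuous; $h:\mathbb{R}^n\to\mathbb{R}$ is convex; and $F:=f+g-h$ is level-bounded, i.e. $\{x\in\mathbb{R}^n: F(x)\le r\}$ is bounded for each $r\in\mathbb{R}$. $\partial$ denotes the convex subdifferential: $\partial\varphi(u)=\{\xi\in\mathbb{R}^n:\varphi(z)\ge\varphi(u)+\langle\xi,z-u\rangle\ \forall z\in\mathbb{R}^n\}$. For $\alpha>0$ and $\varphi$ proper, lower semicontinuous, convex, ${\rm Prox}_{\alpha\varphi}(x)$ is the unique minimizer over $y\in\mathbb{R}^n$ of $\varphi(y)+\frac{1}{2\alpha}\|x-y\|^2$. A mapping $T:\mathbb{R}^n\to\mathbb{R}^n$ is a contraction with coefficient $L\in[0,1)$ if $\|T(x)-T(y)\|\le L\|x-y\|$ for all $x,y\in\mathbb{R}^n$. *)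

(* Defs.v *)
From HB Require Import structures.
From mathcomp Require Import all_boot all_order all_algebra.
From mathcomp Require Import all_classical all_reals all_analysis.
Set Implicit Arguments.
Unset Strict Implicit.
Unset Printing Implicit Defensive.
Import Order.TTheory GRing.Theory Num.Theory.
Import numFieldNormedType.Exports.

Local Open Scope classical_set_scope.
Local Open Scope ring_scope.

Definition dotv (R : realType) (n : nat) (x y : 'rV[R]_n) : R :=
  \sum_(i < n) x 0 i * y 0 i.

(* The library norm `|x| on 'rV[R]_n is the sup norm, hence this one. The
   topology, differentiability and boundedness are the same for both norms. *)
Definition enorm (R : realType) (n : nat) (x : 'rV[R]_n) : R :=
  Num.sqrt (dotv x x).

Definition gradient (R : realType) (n : nat) (f : 'rV[R]_n -> R)
    (x : 'rV[R]_n) : 'rV[R]_n :=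
  \row_(i < n) 'D_(delta_mx 0 i) f x.

(* Meant for 0 <= L. *)
Definition elipschitz (R : realType) (n : nat) (L : R)
    (T : 'rV[R]_n -> 'rV[R]_n) : Prop :=
  forall x y, enorm (T x - T y) <= L * enorm (x - y).

Definition econtraction (R : realType) (n : nat) (L : R)
    (T : 'rV[R]_n -> 'rV[R]_n) : Prop :=
  0 <= L < 1 /\ elipschitz L T.

Definition eproper (R : realType) (n : nat) (phi : 'rV[R]_n -> \bar R) : Prop :=
  (forall x, (-oo < phi x)%E) /\ (exists x, (phi x < +oo)%E).

(* Only meaningful for phi > -oo, so that no +oo - oo occurs on the right. *)
Definition econvex (R : realType) (n : nat) (phi : 'rV[R]_n -> \bar R) : Prop :=
  forall (x y : 'rV[R]_n) (t : R), 0 < t < 1 ->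
    (phi (t *: x + (1 - t) *: y)%R
       <= t%:E * phi x + (1 - t)%:E * phi y)%E.

Definition level_bounded (R : realType) (n : nat)
    (phi : 'rV[R]_n -> \bar R) : Prop :=
  forall r : R, bounded_set [set x | (phi x <= r%:E)%E].

Definition subdifferential (R : realType) (n : nat) (phi : 'rV[R]_n -> R)
    (u : 'rV[R]_n) : set 'rV[R]_n :=
  [set xi | forall z, phi u + dotv xi (z - u) <= phi z].

Definition argmin (R : realType) (n : nat) (phi : 'rV[R]_n -> \bar R) :
    set 'rV[R]_n :=
  [set x | forall y, (phi x <= phi y)%E].

(* [get] returns a junk value when there is no unique minimizer, which does not
   happen for phi proper, lower semicontinuous and convex and alpha > 0. *)
Definition prox (R : realType) (n : nat) (alpha : R)
    (phi : 'rV[R]_n -> \bar R) (x : 'rV[R]_n) : 'rV[R]_n :=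
  [get p | argmin (fun y =>
     (phi y + (1 / (2 * alpha) * enorm (x - y) ^+ 2)%R%:E)%E) = [set p]].

Definition Tmap (R : realType) (n : nat) (f : 'rV[R]_n -> R)
    (xk etak : 'rV[R]_n) (lambda mu : R) (x : 'rV[R]_n) : 'rV[R]_n :=
  (1 - mu * lambda) *: x - mu *: gradient f x + (mu * lambda) *: xk
  + mu *: etak.

(* Main.v *)
(* Optimality conditions turn both the subproblem and the prox into the same
   inclusion: by strong convexity, x solves the subproblem iff
   etak - grad f x - lambda (x - xk) is a subgradient of g at x, and this vector
   is (T x - x) / mu, so the condition says exactly that x = Prox_{mu g} (T x).
   The calculus is reduced to smooth parts psi squeezed between a tangent and a
   tangent plus a quadratic, which needs no sum rule.
   For the contraction, the prox is nonexpansive by monotonicity of the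
   subdifferential, and with a = 1 - mu lambda, D = x - y and
   G = grad f x - grad f y,
     |T x - T y|^2 = a^2 |D|^2 - 2 a mu <G, D> + mu^2 |G|^2 <= a^2 |D|^2
   because |G|^2 <= L <G, D> (Baillon-Haddad) and mu L <= 2 a.
   The prox is total because g has a linear minorant away from a point of its
   domain, so that the prox objective is coercive. *)

Require Import Defs.
From HB Require Import structures.
From mathcomp Require Import all_boot all_order all_algebra.
From mathcomp Require Import all_classical all_reals all_analysis.
From mathcomp Require Import ring lra.
Import Order.TTheory GRing.Theory Num.Theory.
Import numFieldNormedType.Exports.

Local Open Scope classical_set_scope.
Local Open Scope ring_scope.

(** This stands in for letting [t] tend to 0. If [a < 0], the choice [t = - a / (2 * (|b| - a))]
    gives [b * t <= - a / 2], hence [a + b * t <= a / 2 < 0]. *)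
Lemma ge0_of_perturb {R : realType} (a b : R) :
  (forall t, 0 < t < 1 -> 0 <= a + b * t) -> 0 <= a.
Proof.
move=> h; rewrite leNgt; apply/negP => a0.
have b0 : 0 <= `|b| by [].
have d0 : 0 < 2 * (`|b| - a) by lra.
have /h : 0 < - a / (2 * (`|b| - a)) < 1.
  by rewrite divr_gt0 ?oppr_gt0//= ltr_pdivrMr//; lra.
have : b * (- a / (2 * (`|b| - a))) <= `|b| * (- a / (2 * (`|b| - a))).
  by rewrite ler_wpM2r ?ler_norm// divr_ge0 ?ltW// oppr_gt0.
have -> : `|b| * (- a / (2 * (`|b| - a))) = - a * (`|b| / (2 * (`|b| - a))).
  by rewrite mulrCA.
have : `|b| / (2 * (`|b| - a)) <= 1/2 by rewrite ler_pdivrMr//; lra.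
set q := `|b| / _; set w := b * _; nra.
Qed.

(** * Euclidean inner product and norm *)

Section Dot.
Context {R : realType} {n : nat}.
Implicit Types (x y z : 'rV[R]_n) (a : R).

Lemma dotvC x y : dotv x y = dotv y x.
Proof. by apply: eq_bigr => i _; rewrite mulrC. Qed.

Lemma dotvDl x y z : dotv (x + y) z = dotv x z + dotv y z.
Proof. by rewrite -big_split; apply: eq_bigr => i _; rewrite !mxE mulrDl. Qed.

Lemma dotvZl a x y : dotv (a *: x) y = a * dotv x y.
Proof.
by rewrite /dotv mulr_sumr; apply: eq_bigr => i _; rewrite !mxE mulrA.
Qed.

Lemma dotvNl x y : dotv (- x) y = - dotv x y.
Proof. by rewrite -scaleN1r dotvZl mulN1r. Qed.

Lemma dotvDr x y z : dotv x (y + z) = dotv x y + dotv x z.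
Proof. by rewrite dotvC dotvDl !(dotvC x). Qed.

Lemma dotvZr a x y : dotv x (a *: y) = a * dotv x y.
Proof. by rewrite dotvC dotvZl dotvC. Qed.

Lemma dotvNr x y : dotv x (- y) = - dotv x y.
Proof. by rewrite dotvC dotvNl dotvC. Qed.

Definition dotvE := (dotvDl, dotvDr, dotvZl, dotvZr, dotvNl, dotvNr).

Lemma dotvv_ge0 x : 0 <= dotv x x.
Proof. by apply: sumr_ge0 => i _; rewrite -expr2 sqr_ge0. Qed.

Lemma dotvv_eq0 x : dotv x x <= 0 -> x = 0.
Proof.
move=> x0; have /eqP : dotv x x = 0 by apply/le_anti; rewrite x0 dotvv_ge0.
rewrite psumr_eq0 => [/allP h|i _]; last by rewrite -expr2 sqr_ge0.
apply/rowP => i; rewrite mxE; apply/eqP.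
by have := h i (mem_index_enum i); rewrite -expr2 sqrf_eq0.
Qed.

Lemma sqr_enorm x : enorm x ^+ 2 = dotv x x.
Proof. by rewrite sqr_sqrtr // dotvv_ge0. Qed.

Lemma enorm_ge0 x : 0 <= enorm x. Proof. exact: sqrtr_ge0. Qed.

Lemma enormZ a x : enorm (a *: x) = `|a| * enorm x.
Proof.
by rewrite /enorm !dotvE mulrA -expr2 sqrtrM ?sqr_ge0 // sqrtr_sqr.
Qed.

Lemma norm_coord_le_enorm x i : `|x 0 i| <= enorm x.
Proof.
rewrite -sqrtr_sqr ler_wsqrtr // /dotv (bigD1 i) //= -expr2 lerDl.
by apply: sumr_ge0 => j _; rewrite -expr2 sqr_ge0.
Qed.

(** Cauchy-Schwarz: the squared norm of [|y|^2 x - <x, y> y] equals [|y|^2 (|x|^2 |y|^2 - <x, y>^2)]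
    and is nonnegative. *)
Lemma dotv_le_enorm x y : dotv x y <= enorm x * enorm y.
Proof.
rewrite (le_trans (ler_norm _))// -sqrtrM ?dotvv_ge0// -sqrtr_sqr ler_wsqrtr//.
have := dotvv_ge0 (dotv y y *: x - dotv x y *: y).
have := dotvv_ge0 y; rewrite le_eqVlt => /orP[/eqP y0|y0].
  have -> : y = 0 by apply: dotvv_eq0; rewrite -y0.
  by rewrite -(scale0r x) !dotvE !mul0r mulr0 expr0n.
rewrite !dotvE (dotvC y x) => h.
rewrite -(ler_pM2l y0); lra.
Qed.

End Dot.

(** * Gradient inequalities for smooth convex functions *)

Section Smooth.
Context {R : realType} {n : nat}.
Variable f : 'rV[R]_n -> R.
Hypothesis f_diff : forall x, differentiable f x.

Lemma derive_gradient x d : 'D_d f x = dotv (gradient f x) d.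
Proof.
rewrite deriveE// {1}(row_sum_delta d) linear_sum/= /dotv.
by apply: eq_bigr => i _; rewrite linearZ/= mxE deriveE// mulrC.
Qed.

Lemma is_derive_line x d (t : R) :
  is_derive t 1 (fun s => f (x + s *: d)) (dotv (gradient f (x + t *: d)) d).
Proof.
have e : (fun h => h^-1 *: (f (x + (h *: 1 + t) *: d) - f (x + t *: d)))
       = (fun h => h^-1 *: (f (h *: d + (x + t *: d)) - f (x + t *: d))).
  by apply/funext => h; rewrite [h *: 1]mulr1 scalerDl addrCA.
apply: DeriveDef; first by rewrite /derivable e; exact: diff_derivable.
by rewrite /derive e -derive_gradient.
Qed.

Hypothesis f_convex : convex_function [set: convex_lmodType 'rV[R]_n] f.

(** Convexity bounds the difference quotient along [z - x] by [f z - f x] for steps in (0, 1) only,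
    so the derivative is taken as a limit from the right. *)
Lemma convex_ge_tangent x z : f x + dotv (gradient f x) (z - x) <= f z.
Proof.
rewrite addrC -lerBrDr -derive_gradient.
have dv : derivable f x (z - x) by exact: diff_derivable.
rewrite /derive cvg_at_rightE//; apply: limr_le.
  exact/cvgP/cvg_dnbhs_at_right/dv.
have : \forall t \near (0 : R)^'+, 0 < t < 1.
  near=> t; apply/andP; split; near: t; first exact: nbhs_right_gt.
  exact: nbhs_right_lt.
apply: filterS => t /andP[t0 t1].
rewrite [_ *: _]mulrC ler_pdivrMr//.
have := f_convex (Itv01 (ltW t0) (ltW t1)) z x (in_setT _) (in_setT _).
rewrite convRE/= /conv/= /unstable.onem => h.
have -> : t *: (z - x) + x = t *: z + (1 - t) *: x.
  by rewrite scalerBr scalerBl scale1r addrAC addrA.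
by rewrite lerBlDr (le_trans h)//; lra.
Unshelve. all: by end_near. Qed.

Lemma gradient_monotone x y :
  0 <= dotv (gradient f x - gradient f y) (x - y).
Proof.
have := convex_ge_tangent x y; have := convex_ge_tangent y x.
by rewrite !dotvE; lra.
Qed.

Variable L : R.
Hypothesis L_gt0 : 0 < L.
Hypothesis f_lip : elipschitz L (gradient f).

(** The mean value theorem replaces integration of the gradient: along the segment, [f] minus the
    quadratic bound has derivative at most 0, by Cauchy-Schwarz and the Lipschitz condition. *)
Lemma descent x y :
  f y <= f x + dotv (gradient f x) (y - x) + L / 2 * enorm (y - x) ^+ 2.
Proof.
set d := y - x; set c := dotv _ d; set N := enorm d ^+ 2.
pose phi s := f (x + s *: d) - (s * c + L / 2 * N * s ^+ 2).
pose dphi s := dotv (gradient f (x + s *: d)) d - (c + L * N * s).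
have dphiE (s : R) : is_derive s 1 phi (dphi s).
  have := is_derive_line x d s => ?.
  apply: is_derive_eq; rewrite /dphi /GRing.scale/=.
  by congr (_ - _); field.
have [s] : exists2 s, s \in `]0, 1[%R & phi 1 - phi 0 = dphi s * (1 - 0).
  apply: MVT => //; apply: derivable_within_continuous => s _.
  exact: ex_derive.
rewrite in_itv/= => /andP[s0 s1].
have : dphi s <= 0.
  rewrite subr_le0 -lerBlDl -/c /c -dotvNl -dotvDl.
  rewrite (le_trans (dotv_le_enorm _ _))//.
  have := f_lip (x + s *: d) x.
  rewrite addrAC subrr add0r enormZ gtr0_norm// => h.
  by have := ler_wpM2r (enorm_ge0 d) h; rewrite /N; lra.
have xd : x + d = y by rewrite addrC subrK.
by rewrite /phi scale1r scale0r addr0 xd; lra.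
Qed.

(** The tangent bound at [x] and the descent bound at [y] are compared at [y - L^-1 *: G], a
    gradient step from [y] for the convex function [f - <gradient f x, .>], whose gradient at [y] is
    [G]. *)
Lemma cocoercive_ineq x y :
  f x + dotv (gradient f x) (y - x)
    + (2 * L)^-1 * enorm (gradient f y - gradient f x) ^+ 2 <= f y.
Proof.
set G := _ - gradient f x.
have := convex_ge_tangent x (y - L^-1 *: G).
have := descent y (y - L^-1 *: G).
have -> : y - L^-1 *: G - y = - (L^-1 *: G) by rewrite addrAC subrr add0r.
have -> : y - L^-1 *: G - x = (y - x) - (L^-1 *: G) by rewrite addrAC.
rewrite !sqr_enorm invfM.
have : dotv G G = dotv (gradient f y) G - dotv (gradient f x) G.
  by rewrite {1}/G !dotvE.
rewrite ![dotv _ (_ - _ *: _)]dotvDr !dotvNr dotvNl opprK !(dotvZl, dotvZr).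
have -> : L / 2 * (L^-1 * (L^-1 * dotv G G)) = L^-1 / 2 * dotv G G.
  by field; rewrite gt_eqF.
have : 0 < L^-1 by rewrite invr_gt0.
set a := dotv G G; set b := dotv _ G; set c := dotv _ G; move: L^-1 => l l0 ->.
set u := dotv _ (y - x); lra.
Qed.

(** Baillon-Haddad: the sum of the previous inequality and its copy with [x] and [y] exchanged. *)
Lemma gradient_cocoercive x y :
  enorm (gradient f x - gradient f y) ^+ 2
    <= L * dotv (gradient f x - gradient f y) (x - y).
Proof.
have := cocoercive_ineq x y; have := cocoercive_ineq y x.
rewrite -ler_pdivrMl// !sqr_enorm invfM !dotvE; lra.
Qed.
End Smooth.

(** * Lower semicontinuity and minima on compact sets *)

Section Ereal.
Local Open Scope ereal_scope.

Lemma ereal_lt_between {R : realType} (x y : \bar R) :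
  x < y -> exists r : R, x < r%:E < y.
Proof.
case: x y => [x| |] [y| |]//=.
- rewrite lte_fin => xy; exists ((x + y) / 2)%R.
  by rewrite !lte_fin; lra.
- by move=> _; exists (x + 1)%R; rewrite ltry lte_fin; lra.
- by move=> _; exists (y - 1)%R; rewrite ltNyr lte_fin; lra.
- by move=> _; exists 0%R; rewrite ltNyr ltry.
Qed.

(** The sets [B a] with [a] above the infimum [m] generate a proper filter on [K]. At a cluster
    point [p], [m < phi p] is impossible: a level [a] in between has a neighbourhood of [p] disjoint
    from [B a]. *)
Lemma lower_semicontinuous_compact_min {R : realType} {T : topologicalType}
    (phi : T -> \bar R) (K : set T) :
  lower_semicontinuous phi -> compact K -> K !=set0 ->
  exists2 p, K p & forall y, K y -> phi p <= phi y.
Proof.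
move=> lsc cK [y0 Ky0]; pose m := ereal_inf (phi @` K).
have m_le y : K y -> m <= phi y.
  by move=> Ky; apply: ereal_inf_lbound; exists y.
(* If [m] is [+oo], no level lies above it and the filter base would be empty; but then every point
   of [K] is a minimizer. *)
have [moo|moo] := eqVneq m +oo.
  exists y0 => // y Ky; have := m_le y Ky.
  by rewrite moo leye_eq => /eqP ->; exact: leey.
pose B a := K `&` [set y | phi y < a].
pose F := filter_from [set a | m < a] B.
have FF : ProperFilter F.
  apply: filter_from_proper.
    apply: filter_from_filter; first by exists +oo; rewrite /= ltey.
    move=> a b ma mb; exists (mine a b); first by rewrite /= lt_min ma.
    by move=> y [Ky /=]; rewrite lt_min => /andP[ya yb]; split.
  by move=> a ma; have [_ [y Ky <-] ya] := ereal_inf_lt ma; exists y.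
have FK : F K by exists +oo; [rewrite /= ltey|move=> y []].
have [p [Kp clp]] := cK F FF FK; exists p => // y Ky.
apply: le_trans (m_le y Ky); rewrite leNgt; apply/negP => mp.
have [a /andP[ma ap]] := ereal_lt_between _ _ mp.
have [V Vp aV] := lsc p a ap.
have FB : F (B a%:E) by exists a%:E.
have [w [[_ /= wa] Vw]] := clp _ _ FB Vp.
by have := lt_trans wa (aV w Vw); rewrite ltxx.
Qed.

Lemma lower_semicontinuousD {R : realType} {T : topologicalType}
    (phi : T -> \bar R) (q : T -> R) :
  lower_semicontinuous phi -> continuous q ->
  lower_semicontinuous (fun y => phi y + (q y)%:E).
Proof.
move=> lsc cq p a.
(* A real [b] between [a - q p] and [phi p] splits the bound: near [p], both [b < phi] and
   [a - b < q] hold. *)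
rewrite -lteBlDr// -EFinB => /ereal_lt_between[b /andP[ab bp]].
have [V Vp bV] := lsc p b bp.
have qp : nbhs p [set y | a - b < q y]%R.
  by apply: (cvgr_gt _ (cq p)); move: ab; rewrite lte_fin; lra.
exists (V `&` [set y | a - b < q y]%R); first exact: filterI.
move=> y [Vy /= qy]; rewrite -lteBlDr// -EFinB (le_lt_trans _ (bV y Vy))//.
by rewrite lee_fin; lra.
Qed.

End Ereal.

(** * Compact cubes *)

Section Box.
Context {R : realType} {n : nat}.

(** A cube rather than a Euclidean ball: it is a product of segments, hence compact, and a point
    outside it still has Euclidean distance above [r] from the centre. *)
Definition box (y0 : 'rV[R]_n) (r : R) : set 'rV[R]_n :=
  [set y | forall i, `|y 0 i - y0 0 i| <= r].

Lemma compact_box y0 r : compact (box y0 r).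
Proof.
have -> : box y0 r =
    [set y | forall i, `[y0 0 i - r, y0 0 i + r]%classic (y 0 i)].
  by apply/seteqP; split=> y h i; have := h i; rewrite /= in_itv/= ler_distl.
apply: (@rV_compact R n (fun i => `[y0 0 i - r, y0 0 i + r]%classic)) => i.
exact: segment_compact.
Qed.

Lemma box_center y0 r : 0 <= r -> box y0 r y0.
Proof. by move=> r0 i; rewrite subrr normr0. Qed.

Lemma notin_box_enorm y0 r y : ~ box y0 r y -> r < enorm (y - y0).
Proof.
move=> /existsNP[i /negP]; rewrite -ltNge => /lt_le_trans; apply.
by have := norm_coord_le_enorm (y - y0) i; rewrite !mxE.
Qed.

Lemma continuous_sqr_enorm (z : 'rV[R]_n) (a : R) :
  continuous (fun y : 'rV[R]_n => a * enorm (z - y) ^+ 2).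
Proof.
have -> : (fun y => a * enorm (z - y) ^+ 2) =
    (fun y : 'rV[R]_n => a * \sum_(i < n) (z 0 i - y 0 i) * (z 0 i - y 0 i)).
  apply/funext => y; rewrite sqr_enorm /dotv.
  by under eq_bigr do rewrite !mxE.
move=> y; apply: (@cvgMr _ _ (nbhs y)).
apply: cvg_big => [|i _]; first exact: add_continuous.
by apply: (@cvgM _ _ (nbhs y));
  (apply: (@cvgB _ _ _ (nbhs y)); [exact: cvg_cst|exact: coord_continuous]).
Qed.
End Box.

(** * Subgradients of extended-valued functions and optimality conditions *)

Section Subgradient.
Context {R : realType} {n : nat}.
Variable g : 'rV[R]_n -> \bar R.

(** Finiteness at [p] is built in so that subgradient inequalities can be combined in the reals. *)
Definition esubgradient (p v : 'rV[R]_n) : Prop :=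
  g p \is a fin_num /\ forall y, (g p + (dotv v (y - p))%:E <= g y)%E.

Lemma esubgradient_monotone p q u w :
  esubgradient p u -> esubgradient q w -> 0 <= dotv (u - w) (p - q).
Proof.
move=> [/fineK gp hp] [/fineK gq hq].
have := hp q; have := hq p; rewrite -gp -gq -!EFinD !lee_fin.
by rewrite !dotvE; lra.
Qed.

Hypothesis g_proper : eproper g.
Hypothesis g_convex : econvex g.

(** From right to left, the subgradient inequality is added to the tangent bound on [psi]. From left
    to right, [x] is compared with [x + t (y - x)]: after convexity of [g] and division by [t], the
    quadratic bound leaves an error [C * t * |y - x|^2], which vanishes with [t]. *)
Lemma argmin_esubgradient (psi : 'rV[R]_n -> R) (x v : 'rV[R]_n) (C : R) :
  (forall y, psi x + dotv v (y - x) <= psi y) ->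
  (forall y, psi y <= psi x + dotv v (y - x) + C * enorm (y - x) ^+ 2) ->
  argmin (fun y => (g y + (psi y)%:E)%E) x <-> esubgradient x (- v).
Proof.
case: g_proper => gNy [y0 gy0] psi_ge psi_le.
split=> [xmin|[gx xsub] y]; last first.
  have := xsub y; rewrite -(fineK gx); case: (g y) (gNy y) => [s _|_ _|//].
    by rewrite -!EFinD !lee_fin dotvNl; have := psi_ge y; lra.
  by rewrite addye// leey.
have gx : g x \is a fin_num.
  rewrite fin_real// gNy/=.
  have := xmin y0; case: (g x) (g y0) gy0 => [r| |] [s| |]// _ _.
  by rewrite ltry.
split; first exact: gx.
move=> y; move: gx xmin; case E : (g x) => [r| |]// _ xmin.
case E' : (g y) (gNy y) => [s| |]// _; last by rewrite leey.
rewrite -EFinD lee_fin dotvNl -subr_ge0.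
apply: (@ge0_of_perturb _ _ (C * enorm (y - x) ^+ 2)) => t /andP[t0 t1].
have := g_convex y x t; rewrite t0 t1 => /(_ isT); rewrite E E'.
set w := t *: y + _; have wx : w - x = t *: (y - x).
  by rewrite /w scalerBr scalerBl scale1r addrA addrAC addrK.
have := xmin w; rewrite E; case: (g w) (gNy w) => [c _| _|//]; last first.
  by rewrite -!EFinM -EFinD.
rewrite -!EFinM -!EFinD !lee_fin => h1 h2.
have := psi_le w; rewrite wx dotvZr enormZ gtr0_norm// exprMn => h3.
rewrite -(pmulr_rge0 _ t0).
have : 0 <= t * s + (1 - t) * r + (psi x + t * dotv v (y - x)
    + C * (t ^+ 2 * enorm (y - x) ^+ 2)) - (r + psi x) by lra.
lra.
Qed.

(** Uniqueness: the lower bound gives [<G p - G q, p - q> >= 2 c |p - q|^2], while monotonicity of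
    the subgradients [- G p] and [- G q] makes the left side at most 0. *)
Lemma argmin_set1P (psi : 'rV[R]_n -> R) (G : 'rV[R]_n -> 'rV[R]_n) (c C : R) :
  0 < c ->
  (forall x y, psi x + dotv (G x) (y - x) + c * enorm (y - x) ^+ 2 <= psi y) ->
  (forall x y, psi y <= psi x + dotv (G x) (y - x) + C * enorm (y - x) ^+ 2) ->
  forall p, [/\ argmin (fun y => (g y + (psi y)%:E)%E) = [set p]
                  <-> argmin (fun y => (g y + (psi y)%:E)%E) p
              & argmin (fun y => (g y + (psi y)%:E)%E) p
                  <-> esubgradient p (- G p)].
Proof.
move=> c0 psi_ge psi_le.
have eqv x :
    argmin (fun y => (g y + (psi y)%:E)%E) x <-> esubgradient x (- G x).
  apply: (@argmin_esubgradient psi x (G x) C) => // y.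
  rewrite (le_trans _ (psi_ge x y))// lerDl mulr_ge0 ?(ltW c0)//.
  by rewrite sqr_enorm dotvv_ge0.
move=> p; split=> //; split=> [->//|pmin].
apply/seteqP; split=> [q qmin|q ->//] /=.
have := esubgradient_monotone _ _ _ _ ((eqv p).1 pmin) ((eqv q).1 qmin).
have := psi_ge p q; have := psi_ge q p.
rewrite !sqr_enorm => h1 h2 h3; apply/subr0_eq/dotvv_eq0.
move: h1 h2 h3; rewrite !dotvE (dotvC p q).
set a := dotv p p; set b := dotv q q; set d := dotv q p => h1 h2 h3.
rewrite -(pmulr_rle0 _ c0); lra.
Qed.

End Subgradient.

(** * The proximal map: existence, characterization, nonexpansiveness *)

Section Prox.
Context {R : realType} {n : nat}.
Variable g : 'rV[R]_n -> \bar R.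
Hypothesis g_proper : eproper g.
Hypothesis g_convex : econvex g.
Hypothesis g_lsc : lower_semicontinuous g.
Variable mu : R.
Hypothesis mu_gt0 : 0 < mu.

Let obj (z y : 'rV[R]_n) := (g y + (1 / (2 * mu) * enorm (z - y) ^+ 2)%R%:E)%E.

Let quad_expand (z x y : 'rV[R]_n) :
  1 / (2 * mu) * enorm (z - y) ^+ 2 = 1 / (2 * mu) * enorm (z - x) ^+ 2
    + dotv (mu^-1 *: (x - z)) (y - x) + 1 / (2 * mu) * enorm (y - x) ^+ 2.
Proof.
rewrite !sqr_enorm !dotvE (dotvC x z) (dotvC y z) (dotvC x y).
by field; rewrite gt_eqF.
Qed.

Lemma prox_objective_argminP z p :
  [/\ argmin (obj z) = [set p] <-> argmin (obj z) p
    & argmin (obj z) p <-> esubgradient g p (mu^-1 *: (z - p))].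
Proof.
have := @argmin_set1P _ _ g g_proper g_convex
  (fun y => 1 / (2 * mu) * enorm (z - y) ^+ 2) (fun x => mu^-1 *: (x - z))
  (1 / (2 * mu)) (1 / (2 * mu)).
rewrite divr_gt0 ?mulr_gt0// => /(_ isT).
case/(_ _ _ p) => [x y|x y|e1 e2]; [by rewrite (quad_expand z x y)..|].
by split=> //; rewrite e2 -scalerN opprB.
Qed.

Lemma prox_objective_has_argmin z : argmin (obj z) !=set0.
Proof.
case: g_proper => gNy [y0 gy0].
have [G0 gy0E] : exists G0, g y0 = G0%:E.
  by exists (fine (g y0)); rewrite fineK// fin_real// gNy.
(* The minimum [m] of [g] on the unit cube around [y0] fixes the slope [G0 - m] of the minorant. *)
have [p1 _ p1min] := lower_semicontinuous_compact_min _ _ g_lsc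
  (compact_box y0 1) (ex_intro _ y0 (box_center y0 _ ler01)).
have [m gp1E] : exists m, g p1 = m%:E.
  have := p1min _ (box_center y0 _ ler01).
  by rewrite gy0E; case: (g p1) (gNy p1) => // m _ _; exists m.
have mG0 : m <= G0.
  by rewrite -lee_fin -gp1E -gy0E; exact/p1min/box_center.
(* Convexity propagates the bound on the unit box to a linear minorant. *)
have minorant y s : 1 < enorm (y - y0) -> g y = s%:E ->
    G0 - (G0 - m) * enorm (y - y0) <= s.
  set r := enorm _ => r1 gyE.
  have r0 : 0 < r by lra.
  have := g_convex y y0 r^-1; rewrite invr_gt0 r0 invf_lt1// r1 => /(_ isT).
  set w := _ *: y + _.
  have wy0 : w - y0 = r^-1 *: (y - y0).
    by rewrite /w scalerBr scalerBl scale1r addrA addrAC addrK.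
  have wbox : box y0 1 w.
    move=> i; have := norm_coord_le_enorm (w - y0) i.
    rewrite wy0 enormZ -/r [`|r^-1|]gtr0_norm ?invr_gt0// mulVf ?gt_eqF//.
    by rewrite -wy0 !mxE.
  have := p1min _ wbox; rewrite gp1E gyE gy0E => h1 h2.
  have := le_trans h1 h2; rewrite -!EFinM -EFinD lee_fin.
  rewrite -(ler_pM2l r0) mulrDr !mulrA mulrBr mulfV ?gt_eqF// mulr1; lra.
pose a := enorm (z - y0).
(* Outside the cube of radius [rho] the objective is at least its value at [y0]: the term 1 makes
   the minorant available, the others let [r ^+ 2] absorb the decrease of the minorant and the cross
   term [2 * d]. *)
pose rho := 1 + 2 * mu * (G0 - m) + 2 * a.
have a0 : 0 <= a by exact: enorm_ge0.
have rho0 : 0 <= 2 * mu * (G0 - m).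
  by rewrite mulr_ge0 ?subr_ge0// mulr_ge0// ltW.
have rho1 : 0 <= rho by rewrite /rho; lra.
have [p pbox pmin] := lower_semicontinuous_compact_min _ _
  (lower_semicontinuousD _ _ g_lsc (continuous_sqr_enorm z (1 / (2 * mu))))
  (compact_box y0 rho) (ex_intro _ y0 (box_center y0 _ rho1)).
exists p => y; have [/pmin//|/notin_box_enorm yrho] := pselect (box y0 rho y).
apply: le_trans (pmin _ (box_center y0 _ rho1)) _; rewrite /= /obj gy0E.
case gyE : (g y) (gNy y) => [s| |]// _; last by rewrite addye// leey.
have := minorant y s _ gyE; set r := enorm (y - y0) in yrho * => /(_ _).
rewrite -!EFinD lee_fin (quad_expand z y0 y) -/a -/r => h.
have /h {}h : 1 < r by move: yrho; rewrite /rho; lra.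
have : dotv (z - y0) (y - y0) <= a * r := dotv_le_enorm _ _.
rewrite -[y0 - z]opprB scalerN dotvNl dotvZl.
set d := dotv _ _ => da.
have r0 : 0 <= r by exact: enorm_ge0.
have key : 2 * mu * (G0 - m) * r + 2 * d <= r ^+ 2.
  have : rho * r <= r * r by rewrite ler_wpM2r// ltW.
  by rewrite /rho; lra.
have : (2 * mu)^-1 * (2 * mu * (G0 - m) * r + 2 * d) <= (2 * mu)^-1 * r ^+ 2.
  by rewrite ler_pM2l// invr_gt0 mulr_gt0.
have -> : (2 * mu)^-1 * (2 * mu * (G0 - m) * r + 2 * d)
    = (G0 - m) * r + mu^-1 * d by field; rewrite gt_eqF.
by lra.
Qed.

Lemma proxP z p : prox mu g z = p <-> esubgradient g p (mu^-1 *: (z - p)).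
Proof.
have [p0 p0min] := prox_objective_has_argmin z.
have [e1 e2] := prox_objective_argminP z p; rewrite -e2 -e1.
(* Existence and uniqueness of the minimizer rule out the default value of [get]. *)
have e : argmin (obj z) = [set prox mu g z].
  apply: (@xgetPex _ point [set q | argmin (obj z) = [set q]]).
  by exists p0; have [[_ +] _] := prox_objective_argminP z p0; exact.
split=> [<-//|ep]; have : [set prox mu g z] p by rewrite -e ep.
by [].
Qed.

(** Monotonicity gives [|d|^2 <= <z - w, d> <= |z - w| |d|] for the difference [d] of the images;
    [|d|] cancels unless [d = 0]. *)
Lemma prox_nonexpansive z w :
  enorm (prox mu g z - prox mu g w) <= enorm (z - w).
Proof.
have := esubgradient_monotone g _ _ _ _
  ((proxP z _).1 erefl) ((proxP w _).1 erefl).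
set p := prox _ _ z; set q := prox _ _ w; set d := p - q.
have [->|d0] := eqVneq d 0.
  by rewrite -(scale0r z) enormZ normr0 mul0r enorm_ge0.
rewrite -scalerBr dotvZl pmulr_rge0 ?invr_gt0//.
have -> : z - p - (w - q) = (z - w) - d.
  by apply/rowP => i; rewrite /d !mxE; ring.
rewrite dotvDl dotvNl subr_ge0 -sqr_enorm expr2.
move=> /le_trans/(_ (dotv_le_enorm _ _)).
rewrite ler_pM2r// lt0r enorm_ge0 andbT.
by apply: contra_neq d0 => e; apply: dotvv_eq0; rewrite -sqr_enorm e expr0n.
Qed.

End Prox.

(** * The map [Tmap] and the subproblem *)

Section Tmap.
Context {R : realType} {n : nat}.
Variables (f : 'rV[R]_n -> R) (L : R).
Hypothesis L_gt0 : 0 < L.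
Hypothesis f_diff : forall x, differentiable f x.
Hypothesis f_convex : convex_function [set: convex_lmodType 'rV[R]_n] f.
Hypothesis f_lip : elipschitz L (gradient f).
Variables (xk etak : 'rV[R]_n) (lambda : R).
Hypothesis lambda_gt0 : 0 < lambda.

Lemma elipschitz_Tmap mu : 0 < mu -> mu * (2 * lambda + L) <= 2 ->
  elipschitz (1 - mu * lambda) (Tmap f xk etak lambda mu).
Proof.
move=> mu0 muL x y.
(* The sign of the coefficient allows the claim to be squared and [muL] to be used as
   [mu * L <= 2 * (1 - mu * lambda)]. *)
have a0 : 0 <= 1 - mu * lambda by have := mulr_gt0 mu0 L_gt0; lra.
set d := x - y; set G := gradient f x - gradient f y.
have -> : Tmap f xk etak lambda mu x - Tmap f xk etak lambda mu y
    = (1 - mu * lambda) *: d - mu *: G.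
  by apply/rowP => i; rewrite /Tmap /d /G !mxE; ring.
have := gradient_cocoercive f f_diff f_convex L L_gt0 f_lip x y.
have := gradient_monotone f f_diff f_convex x y.
rewrite -/d -/G; move: d G => d G Gd; rewrite sqr_enorm => GG.
rewrite -(ler_pXn2r (isT : (0 < 2)%N)) ?nnegrE ?mulr_ge0 ?enorm_ge0//.
rewrite exprMn !sqr_enorm !dotvE (dotvC d G).
have : mu * mu * dotv G G <= mu * mu * (L * dotv G d).
  by rewrite ler_wpM2l// mulr_ge0// ltW.
have : mu * (mu * L) * dotv G d <= mu * (2 * (1 - mu * lambda)) * dotv G d.
  by rewrite ler_wpM2r// ler_pM2l//; lra.
lra.
Qed.

Lemma subproblem_argminP (g : 'rV[R]_n -> \bar R) (p : 'rV[R]_n) :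
  eproper g -> econvex g ->
  argmin (fun x => ((f x)%:E + g x - (dotv etak x)%:E
                    + (lambda / 2 * enorm (x - xk) ^+ 2)%R%:E)%E) = [set p]
  <-> esubgradient g p (etak - gradient f p - lambda *: (p - xk)).
Proof.
move=> g_proper g_convex.
pose psi x := f x - dotv etak x + lambda / 2 * enorm (x - xk) ^+ 2.
pose G x := gradient f x - etak + lambda *: (x - xk).
have -> : (fun x => ((f x)%:E + g x - (dotv etak x)%:E
    + (lambda / 2 * enorm (x - xk) ^+ 2)%R%:E)%E)
    = (fun x => (g x + (psi x)%:E)%E).
  apply/funext => x.
  by rewrite -EFinN [((f x)%:E + _)%E]addeC -!addeA -!EFinD addrA.
(* The gap between [psi] and its tangent is that of [f] plus an exact quadratic; the gap of [f] lies
   between 0 and [L / 2 * |y - x|^2]. *)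
have psiE x y : psi y = f y - f x - dotv (gradient f x) (y - x)
    + (psi x + dotv (G x) (y - x)) + lambda / 2 * enorm (y - x) ^+ 2.
  rewrite /psi /G !sqr_enorm !dotvE (dotvC x xk) (dotvC y xk) (dotvC x y).
  by field.
have psi_ge x y :
    psi x + dotv (G x) (y - x) + lambda / 2 * enorm (y - x) ^+ 2 <= psi y.
  by rewrite (psiE x y); have := convex_ge_tangent f f_diff f_convex x y; lra.
have psi_le x y : psi y <= psi x + dotv (G x) (y - x)
    + (L / 2 + lambda / 2) * enorm (y - x) ^+ 2.
  by rewrite (psiE x y); have := descent f f_diff L f_lip x y; lra.
have c0 : 0 < lambda / 2 by rewrite divr_gt0.
have [e1 e2] := argmin_set1P g g_proper g_convex psi G _ _ c0 psi_ge psi_le p.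
rewrite e1 e2; suff -> : - G p = etak - gradient f p - lambda *: (p - xk) by [].
by rewrite /G opprD opprB.
Qed.

End Tmap.

Theorem lemma3p1 (R : realType) (n : nat)
  (f : 'rV[R]_n -> R) (g : 'rV[R]_n -> \bar R) (h : 'rV[R]_n -> R) (Lf : R)
  (Lf_gt0 : 0 < Lf)
  (f_diff : forall x, differentiable f x)
  (f_convex : convex_function [set: convex_lmodType 'rV[R]_n] f)
  (f_lip : elipschitz Lf (gradient f))
  (g_proper : eproper g)
  (g_convex : econvex g)
  (g_lsc : lower_semicontinuous g)
  (h_convex : convex_function [set: convex_lmodType 'rV[R]_n] h)
  (F_level_bounded :
     level_bounded (fun x => ((f x)%:E + g x - (h x)%:E)%E))
  (xk etak : 'rV[R]_n) (etak_sub : subdifferential h xk etak) :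
  (forall lambda mu : R, 0 < lambda -> 0 < mu ->
   forall xk1 : 'rV[R]_n,
     argmin (fun x => ((f x)%:E + g x - (dotv etak x)%:E
                       + (lambda / 2 * enorm (x - xk) ^+ 2)%R%:E)%E)
       = [set xk1]
     <-> prox mu g (Tmap f xk etak lambda mu xk1) = xk1)
  /\
  (forall lambda mu : R, 0 < lambda -> mu \in `]0, 2 / (2 * lambda + Lf)] ->
     econtraction (1 - mu * lambda) (prox mu g \o Tmap f xk etak lambda mu))
  /\
  (forall lambda : R, 0 < lambda ->
     [/\ 2 / (2 * lambda + Lf) \in `]0, 2 / (2 * lambda + Lf)],
         1 - 2 / (2 * lambda + Lf) * lambda = Lf / (2 * lambda + Lf)
       & forall mu : R, mu \in `]0, 2 / (2 * lambda + Lf)] ->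
           Lf / (2 * lambda + Lf) <= 1 - mu * lambda]).
Proof.
have den0 lambda : 0 < lambda -> 0 < 2 * lambda + Lf by lra.
split; [|split] => [lambda mu l0 mu0 p|lambda mu l0|lambda l0].
- rewrite (subproblem_argminP f Lf f_diff f_convex f_lip)//.
  rewrite (proxP g g_proper g_convex g_lsc mu mu0).
  have -> // : mu^-1 *: (Tmap f xk etak lambda mu p - p)
      = etak - gradient f p - lambda *: (p - xk).
  by apply/rowP => i; rewrite /Tmap !mxE; field; rewrite gt_eqF.
- rewrite in_itv/= => /andP[mu0]; rewrite ler_pdivlMr ?den0// => muL.
  have := mulr_gt0 mu0 l0; have := mulr_gt0 mu0 Lf_gt0 => h1 h2.
  split=> [|x y]; first by apply/andP; split; lra.
  apply: le_trans (prox_nonexpansive g g_proper g_convex g_lsc mu mu0 _ _) _.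
  exact: (elipschitz_Tmap f Lf).
- have d0 := den0 _ l0; split.
  + by rewrite in_itv/= lexx divr_gt0.
  + by field; rewrite gt_eqF.
  + move=> mu; rewrite in_itv/= => /andP[mu0]; rewrite ler_pdivlMr// => muL.
    (* Multiplying [muL] by [lambda] gives [(1 - mu * lambda) * (2 * lambda + Lf) >= 2 * lambda + Lf
       - 2 * lambda]. *)
    by rewrite ler_pdivrMr//; nra.
Qed.
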